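(* Let $1\le k\le d-1$ be integers. If $d-k$ is even, then $$n(k,d)\le \min_{0\le h\le \frac{d-k-2}{2}}\max\left\{2^h\sum_{j=0}^{k}\binom{d-h}{j},\ \sum_{j=h+1}^{\frac{d-k-2}{2}}\left(\frac{1}{2^{j+1}}-\frac{1}{2^{d-k-j}}\right)\left|B_{k+2j}^{(d)}\right|+2^{\frac{d+k}{2}}\right\}.$$ If $d-k$ is odd, then $$n(k,d)\le \min_{0\le h\le \frac{d-k-3}{2}}\max\left\{2^h\sum_{j=0}^{k}\binom{d-h}{j},\ \sum_{j=h+1}^{\frac{d-k-3}{2}}\left(\frac{1}{2^{j+1}}-\frac{1}{2^{d-k-j}}\right)\left|B_{k+2j}^{(d)}\right|+\frac{1}{2^{\frac{d-k+1}{2}}}\left|B_{d-1}^{(d)}\right|+2^{\frac{d+k-1}{2}}\right\},$$ and also $$n(k,d)\le \max\left\{2^{\frac{d-k-1}{2}}\sum_{j=0}^{k}\binom{\frac{d+k+1}{2}}{j},\ 2^{\frac{d+k-1}{2}}\right\}.$$ Here the minima are over integers $h$.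
   Context: A standard box in $\mathbb{R}^d$ is a set $K=K_1\times\cdots\times K_d$ where each $K_i\subseteq\mathbb{R}$ is a closed interval. A finite family of $d$-dimensional standard boxes in $\mathbb{R}^d$ is called $k$-neighborly if the dimension of the intersection of any two distinct members is in $\{d-k,d-k+1,\ldots,d-1\}$ (in particular the intersection is nonempty). For positive integers $1\le k\le d$, $n(k,d)$ is the maximum number of members of a $k$-neighborly family of $d$-dimensional standard boxes in $\mathbb{R}^d$. For a nonnegative integer $m\le d-1$, the configuration $B_m^{(d)}\subseteq\{0,1\}^d$ is defined as follows: if $m=2t$, it is the set of binary vectors of length $d$ with at most $t$ coordinates equal to $1$; if $m=2t+1$, it is the Cartesian product of $\{0,1\}$ with the set of binary vectors of length $d-1$ with at most $t$ coordinates equal to $1$. Thus $|B_m^{(d)}|=\sum_{i=0}^{t}\binom{d}{i}$ if $m=2t$, and $|B_m^{(d)}|=2\sum_{i=0}^{t}\binom{d-1}{i}$ if $m=2t+1$. Empty sums (upper limit smaller than the lower limit) equal $0$. A minimum over an empty range of $h$ (which occurs only when $d-k=1$) is read as $+\infty$, i.e. that particular bound is void. *)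

(* Defs.v *)
From mathcomp Require Import all_boot all_order all_algebra.
From mathcomp Require Import all_classical all_reals.

Set Implicit Arguments.
Unset Strict Implicit.
Unset Printing Implicit Defensive.
Import Order.TTheory GRing.Theory Num.Theory.
Local Open Scope classical_set_scope.
Local Open Scope ring_scope.

Definition closed_interval (R : realType) (I : set R) : Prop :=
  exists a b : R, a <= b /\ I = `[a, b]%classic.

Definition standard_box (R : realType) (d : nat) (K : set 'rV[R]_d) : Prop :=
  exists I : 'I_d -> set R, (forall i, closed_interval (I i)) /\
    K = [set x | forall i, I i (x 0 i)].

(* [A] is nonempty and its affine hull has dimension [m]: [U] is the direction
   of the affine hull, i.e. the least subspace containing all [y - x], y in A.
   The empty set has no dimension. *)
Definition has_dim (R : realType) (d : nat) (A : set 'rV[R]_d) (m : nat) : Prop :=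
  exists (x : 'rV[R]_d) (U : {vspace 'rV[R]_d}),
    [/\ A x,
        forall y, A y -> y - x \in U,
        forall V : {vspace 'rV[R]_d},
          (forall y, A y -> y - x \in V) -> (U <= V)%VS
      & \dim U = m].

Definition neighborly (R : realType) (k d : nat) (F : set (set 'rV[R]_d)) : Prop :=
  [/\ finite_set F,
      forall K, F K -> standard_box K /\ has_dim K d
    & forall K L, F K -> F L -> K <> L ->
        exists m, (d - k <= m < d)%N /\ has_dim (K `&` L) m].

Definition neighborly_size (R : realType) (k d m : nat) : Prop :=
  exists F : set (set 'rV[R]_d), neighborly k F /\ (F #= `I_m)%card.

(* Boundedness of the sizes, needed for the maximum below to exist. *)

Lemma neighborly_size0 (R : realType) (k d : nat) : neighborly_size R k d 0.
Proof. by exists set0; split; [split | rewrite II0 card_eq0]. Qed.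

Lemma has_dim_neq0 (R : realType) (d m : nat) (A : set 'rV[R]_d) :
  has_dim A m -> A !=set0.
Proof. by move=> [x [U [Ax _ _ _]]]; exists x. Qed.

Lemma full_dim_lt (R : realType) (d : nat) (a b : 'I_d -> R) :
  has_dim [set x : 'rV[R]_d | forall i, a i <= x 0 i <= b i] d ->
  forall i, a i < b i.
Proof.
move=> [x [U [Ax _ Umin dimU]]] i; rewrite ltNge; apply/negP => leba.
have eqx (y : 'rV[R]_d) : (forall j, a j <= y 0 j <= b j) -> y 0 i = a i.
  move=> /(_ i)/andP[h1 h2]; apply/le_anti.
  by rewrite h1 (le_trans h2 leba).
pose f := linfun (mulmxr (delta_mx i 0 : 'cV[R]_d) : 'rV[R]_d -> 'rV[R]_1).
have UV : (U <= lker f)%VS.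
  apply: Umin => y Ay; rewrite memv_ker lfunE /= -colE; apply/eqP/rowP=> j.
  by rewrite !mxE (eqx _ Ay) (eqx _ Ax) subrr.
have UT : U = fullv.
  by apply/eqP; rewrite eqEdim subvf dimvf /dim /= dimU mul1n.
have : (delta_mx 0 i : 'rV[R]_d) \in lker f.
  by apply: (subvP UV); rewrite UT memvf.
rewrite memv_ker lfunE /= mul_delta_mx => /eqP/rowP/(_ 0)/eqP.
by rewrite !mxE !eqxx oner_eq0.
Qed.

Lemma low_dim_degenerate (R : realType) (d m : nat) (a b : 'I_d -> R) :
  has_dim [set x : 'rV[R]_d | forall i, a i <= x 0 i <= b i] m -> (m < d)%N ->
  exists i, b i <= a i.
Proof.
move=> [x [U [Ax Umem _ <-]]] ltd; apply: contrapT => H.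
have lt i : a i < b i by rewrite ltNge; apply/negP => h; apply: H; exists i.
suff UT : U = fullv by move: ltd; rewrite UT dimvf /dim /= mul1n ltnn.
have dU i : (delta_mx 0 i : 'rV[R]_d) \in U.
  have [c [c01 cx]] : exists c, a i <= c <= b i /\ c - x 0 i != 0.
    have [e|ne] := eqVneq (x 0 i) (a i).
      by exists (b i); rewrite lexx ltW//= e subr_eq0 gt_eqF.
    by exists (a i); rewrite lexx ltW//= subr_eq0 eq_sym.
  have : (x + (c - x 0 i) *: delta_mx 0 i) - x \in U.
    apply: Umem => j; rewrite !mxE /=.
    have [->|] := eqVneq j i; first by rewrite mulr1 addrC subrK.
    by rewrite mulr0 addr0.
  by rewrite addrC addKr => h; have := memvZ (c - x 0 i)^-1 h; rewrite scalerA mulVf ?scale1r.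
apply/vspaceP => v; rewrite memvf (row_sum_delta v).
by apply: memv_suml => i _; apply: memvZ.
Qed.

Lemma standard_box_bounds (R : realType) (d : nat) (K : set 'rV[R]_d) :
  standard_box K -> exists ab : ('I_d -> R) * ('I_d -> R),
    K = [set x | forall i, ab.1 i <= x 0 i <= ab.2 i].
Proof.
move=> [I [hI ->]].
have /choice[f hf] : forall i, exists p : R * R, I i = `[p.1, p.2]%classic.
  by move=> i; have [a [b [_ ->]]] := hI i; exists (a, b).
exists (fun i => (f i).1, fun i => (f i).2); apply/seteqP; split => x /= h i.
  by have := h i; rewrite hf /= in_itv.
by rewrite hf /= in_itv; exact: h.
Qed.

Lemma neighborly_size_bound (R : realType) (k d m : nat) :
  neighborly_size R k d m -> (m <= 2 ^ d)%N.
Proof.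
move=> [F [[_ Fbox Fpair]]] /card_esym/card_set_bijP[g [gF ginj _]].
have gFi (i : 'I_m) : F (g i) by apply: gF => /=.
have /choice[ab hab] (i : 'I_m) := standard_box_bounds (Fbox _ (gFi i)).1.
pose a i := (ab i).1; pose b i := (ab i).2.
have ltab (i : 'I_m) j : a i j < b i j.
  by apply: full_dim_lt; rewrite -hab; exact: (Fbox _ (gFi i)).2.
have gne (i j : 'I_m) : i != j -> g i <> g j.
  move=> /eqP ij e; apply: ij; apply: ord_inj.
  by apply: ginj e; rewrite inE/=.
have deg (i j : 'I_m) : i != j -> exists l, b i l <= a j l \/ b j l <= a i l.
  move=> ij; have [n [/andP[_ nd] hn]] := Fpair _ _ (gFi i) (gFi j) (gne _ _ ij).
  have E : g i `&` g j = [set x | forall l,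
      Num.max (a i l) (a j l) <= x 0 l <= Num.min (b i l) (b j l)].
    rewrite (hab i) (hab j); apply/seteqP; split => x /=.
      move=> [h1 h2] l; rewrite ge_max le_min.
      by have /andP[-> ->] := h1 l; have /andP[-> ->] := h2 l.
    move=> h; split=> l; have := h l; rewrite ge_max le_min;
      by move=> /andP[/andP[? ?] /andP[? ?]]; apply/andP.
  rewrite E in hn; have [l] := low_dim_degenerate hn nd.
  rewrite le_max !ge_min => /orP[/orP[h|h]|/orP[h|h]].
  - by have := ltab i l; rewrite ltNge h.
  - by exists l; right.
  - by exists l; left.
  - by have := ltab j l; rewrite ltNge h.
have meet (i j : 'I_m) l : a i l <= b j l.
  have [->|ij] := eqVneq i j; first exact: ltW.
  have [n [_ /has_dim_neq0[x []]]] := Fpair _ _ (gFi i) (gFi j) (gne _ _ ij).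
  rewrite (hab i) (hab j) => /(_ l)/andP[h _] /(_ l)/andP[_ h'].
  exact: le_trans h h'.
pose v (i : 'I_m) : {ffun 'I_d -> bool} := [ffun l => [exists j, b i l <= a j l]].
have sep (i j : 'I_m) l : b i l <= a j l -> v i l != v j l.
  move=> h; rewrite !ffunE.
  have -> : [exists j, b i l <= a j l] by apply/existsP; exists j.
  apply/negP => /eqP/esym/existsP[n hn]; have := ltab j l.
  by rewrite ltNge (le_trans hn (le_trans (meet n i l) h)).
have vinj : injective v.
  move=> i j e; apply/eqP; apply: contrapT => /negP/deg[l [] /sep];
  by rewrite e eqxx.
by have := leq_card _ vinj; rewrite card_ffun card_bool !card_ord.
Qed.

Lemma neighborly_size_ex (R : realType) (k d : nat) :
  exists m, `[< neighborly_size R k d m >].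
Proof. by exists 0%N; apply/asboolP; exact: neighborly_size0. Qed.

Lemma neighborly_size_le (R : realType) (k d m : nat) :
  `[< neighborly_size R k d m >] -> (m <= 2 ^ d)%N.
Proof. by move=> /asboolP; exact: neighborly_size_bound. Qed.

Definition max_neighborly (R : realType) (k d : nat) : nat :=
  ex_maxn (@neighborly_size_ex R k d) (@neighborly_size_le R k d).

(* The elements of odd-index configurations have a free first coordinate. *)
Definition Bconf (d m : nat) : {set d.-tuple bool} :=
  if odd m then [set v : d.-tuple bool | (count id (behead v) <= m./2)%N]%SET
  else [set v : d.-tuple bool | (count id v <= m./2)%N]%SET.

(* Main.v *)
(** Code the boxes of a [k]-neighborly family by subcubes of [{0,1}^d], a star
    marking a coordinate in which the box does not end at the common touching
    point.  Any two subcubes are separated by at least 1 and at most [k]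
    coordinates, so they are disjoint and, giving each point of a subcube with
    [s] stars the weight [2^-s], the size of the family is the total weight.

    If some subcube has at most [h] stars, choosing in every subcube the point
    nearest to it gives the first bound.  Otherwise, antipodal points lie in
    subcubes with [s] and [s'] stars only if [s + s' >= d - k], which bounds the
    weight of each antipodal pair by the smaller star number [j], while the
    points in subcubes with at most [j] stars form a set of diameter at most
    [k + 2j], whose size is bounded by Kleitman's theorem.  Summation by parts
    gives the second bound.

    Kleitman's theorem follows by compression: first downwards, turning the
    diameter condition into [#|A :|: B| <= m], then by shifting one fixed element
    [d] to the others; removing [d] from the sets that contain it then lowers the
    bound on the unions by two, as in Pascal's rule for the bound. *)

From mathcomp Require Import all_boot all_order all_algebra.
From mathcomp Require Import zify ring lra.
Set Implicit Arguments.
Unset Strict Implicit.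
Unset Printing Implicit Defensive.
Import Order.TTheory GRing.Theory Num.Theory.

(** * Compressions of finite families *)

Definition compress (S : finType) (P : pred S) (phi : S -> S) (F : {set S}) :
    {set S} :=
  [set (if P A && (phi A \notin F) then phi A else A) | A in F].

Lemma card_compress (S : finType) (P : pred S) (phi : S -> S) (F : {set S}) :
  {in P &, injective phi} -> #|compress P phi F| = #|F|.
Proof.
move=> inj_phi; apply: card_in_imset => A B AF BF.
case: ifP => [/andP[PA pA]|_]; case: ifP => [/andP[PB pB]|_] //.
- exact: inj_phi.
- by move=> E; rewrite E BF in pA.
- by move=> E; rewrite -E AF in pB.
Qed.

Lemma compress_cases (S : finType) (P : pred S) (phi : S -> S) (F : {set S}) A :
  A \in compress P phi F ->
  (A \in F /\ (P A -> phi A \in F)) \/ (exists2 B, B \in F /\ P B & A = phi B).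
Proof.
case/imsetP => B BF ->; case: ifP => [/andP[PB _]|nPB]; first by right; exists B.
by left; split=> // PB; move: nPB; rewrite PB => /negbFE.
Qed.

(** A compression that moves some member strictly lowers the total of [w], so iterating until
    nothing moves terminates. *)
Lemma exists_compressed (S J : finType) (P : J -> pred S) (phi : J -> S -> S)
    (w : S -> nat) (Q : {set S} -> Prop) :
  (forall j, {in P j &, injective (phi j)}) ->
  (forall j A, P j A -> w (phi j A) < w A) ->
  (forall j F, Q F -> Q (compress (P j) (phi j) F)) ->
  forall F, Q F -> exists G : {set S},
    [/\ Q G, #|G| = #|F| & forall j A, A \in G -> P j A -> phi j A \in G].
Proof.
move=> inj_phi w_phi Qcompress F.
have [n] := ubnP (\sum_(A in F) w A); elim: n F => // n IHn F ltFn QF.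
case: (boolP [forall j, forall A in F, P j A ==> (phi j A \in F)]) => [st|].
  exists F; split=> // j A AF PA.
  by move/forallP/(_ j)/forall_inP/(_ A AF)/implyP: st; apply.
rewrite negb_forall => /existsP[j]; rewrite negb_forall_in.
case/exists_inP => A AF; rewrite negb_imply => /andP[PA pA].
have [|G [QG cG stG]] := IHn _ _ (Qcompress j _ QF).
  rewrite ltnS in ltFn; apply: leq_trans ltFn.
  rewrite big_imset /=; last first.
    apply/imset_injP; exact/eqP/card_compress.
  rewrite (bigD1 A) //= [X in _ < X](bigD1 A) //= PA pA /=.
  rewrite -addSn leq_add ?w_phi // leq_sum // => B _.
  by case: ifP => // /andP[PB _]; exact/ltnW/w_phi.
by exists G; split=> //; rewrite cG card_compress.
Qed.

(** * Down-compressions and shifts *)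

Definition symdiff (T : finType) (A B : {set T}) : {set T} := (A :\: B) :|: (B :\: A).

Lemma symdiffC (T : finType) (A B : {set T}) : symdiff A B = symdiff B A.
Proof. by rewrite /symdiff setUC. Qed.

(** The compressed family is closed under removing elements, so it contains [B :\: A] along with
    [B]; the symmetric difference of [A] and [B :\: A] is [A :|: B]. *)
Lemma diameter_compressed (T : finType) (X : {set T}) (m : nat)
    (F : {set {set T}}) :
  F \subset powerset X -> {in F &, forall A B, #|symdiff A B| <= m} ->
  exists G : {set {set T}}, [/\ G \subset powerset X, #|G| = #|F| &
    {in G &, forall A B, #|A :|: B| <= m}].
Proof.
move=> FX dF.
pose Q (F : {set {set T}}) :=
  F \subset powerset X /\ {in F &, forall A B, #|symdiff A B| <= m}.
pose P (x : T) (A : {set T}) := x \in A.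
pose phi (x : T) (A : {set T}) := A :\ x.
have inj_phi x : {in P x &, injective (phi x)}.
  by move=> A B xA xB E; rewrite -(setD1K xA) -(setD1K xB) -/(phi x A) E.
have [||G [[GX dG] cG stG]] :=
  @exists_compressed _ _ P phi (fun A => #|A|) Q inj_phi _ _ F (conj FX dF).
- by move=> x A xA; rewrite /phi [X in _ < X](cardsD1 x) [x \in A]xA.
- move=> x {FX dF}F [FX dF]; split.
    apply/subsetP => A /compress_cases[[/(subsetP FX)]//|[B [BF _] ->]].
    rewrite powersetE (subset_trans (subsetDl _ _)) //.
    by have := subsetP FX _ BF; rewrite powersetE.
  (* A moved set against one that stays: if [x \in B], then [B :\ x] is in [F], and the pair [A],
     [B :\ x] has the same symmetric difference. *)
  have mixed A B : A \in F -> x \in A -> B \in F -> (x \in B -> B :\ x \in F) ->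
      #|symdiff (A :\ x) B| <= m.
    move=> AF xA BF stB; case: (boolP (x \in B)) => xB.
      apply: leq_trans (dF _ _ AF (stB xB)); apply/subset_leq_card/subsetP => y.
      by rewrite !inE; case: eqVneq => [->|_]; rewrite ?xA ?xB.
    apply: leq_trans (dF _ _ AF BF); apply/subset_leq_card/subsetP => y.
    by rewrite !inE; case: eqVneq => [->|_]; rewrite ?xA ?(negbTE xB).
  move=> A B /compress_cases[[AF stA]|[A0 [AF xA] ->]];
    move=> /compress_cases[[BF stB]|[B0 [BF xB] ->]].
  + exact: dF.
  + by rewrite symdiffC; exact: mixed.
  + exact: mixed.
  + apply: leq_trans (dF _ _ AF BF); apply/subset_leq_card/subsetP => y.
    by rewrite !inE; case: eqVneq.
exists G; split=> // A B AG BG.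
have BAG : B :\: A \in G.
  have : forall s : seq T, B :\: [set y in s] \in G.
    elim=> [|x s IHs]; first by rewrite set_nil setD0.
    rewrite set_cons setUC -setDDl; case: (boolP (x \in B :\: [set y in s])) => xB.
      exact: stG.
    rewrite (_ : _ :\ x = B :\: [set y in s]) //; apply/setP => y; rewrite !inE.
    by case: eqVneq => // ->; move: xB; rewrite !inE => /negbTE.
  by move/(_ (enum A)); rewrite set_enum.
apply: leq_trans (dG _ _ AG BAG); apply/subset_leq_card/subsetP => y.
by rewrite !inE; case: (y \in A); case: (y \in B).
Qed.

Lemma union_shifted (T : finType) (X : {set T}) (d : T) (m : nat)
    (F : {set {set T}}) :
  F \subset powerset X -> {in F &, forall A B, #|A :|: B| <= m} ->
  exists G : {set {set T}}, [/\ G \subset powerset X, #|G| = #|F|,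
    {in G &, forall A B, #|A :|: B| <= m} &
    forall x A, A \in G -> x \in X -> x \notin A -> d \in A ->
      x |: A :\ d \in G].
Proof.
move=> FX uF.
pose Q (F : {set {set T}}) :=
  F \subset powerset X /\ {in F &, forall A B, #|A :|: B| <= m}.
pose P (x : T) (A : {set T}) := [&& x \in X, x \notin A & d \in A].
pose phi (x : T) (A : {set T}) := x |: A :\ d.
have inj_phi x : {in P x &, injective (phi x)}.
  move=> A B /and3P[_ xA dA] /and3P[_ xB dB] E.
  have xAd : x \notin A :\ d by rewrite !inE (negbTE xA) andbF.
  have xBd : x \notin B :\ d by rewrite !inE (negbTE xB) andbF.
  by rewrite -(setD1K dA) -(setD1K dB) -(setU1K xAd) -/(phi x A) E setU1K.
have [||G [[GX dG] cG stG]] :=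
  @exists_compressed _ _ P phi (fun A => d \in A) Q inj_phi _ _ F (conj FX uF).
- move=> x A /and3P[_ xA dA]; rewrite dA /phi !inE eqxx /= orbF.
  by case: eqVneq xA => // <-; rewrite dA.
- move=> x {FX uF}F [FX uF]; split.
    apply/subsetP => A /compress_cases[[/(subsetP FX)]//|[B [BF PB] ->]].
    have := subsetP FX _ BF; rewrite !powersetE => BX; case/and3P: PB => xX _ _.
    by rewrite subUset sub1set xX (subset_trans (subsetDl _ _)).
  have card_shift (C : {set T}) : d \in C -> #|x |: C :\ d| <= #|C|.
    by move=> dC; rewrite cardsU1 [X in _ <= X](cardsD1 d) dC leq_add2r leq_b1.
  (* If [B] could move, [A :|: phi x B] is the same union. Otherwise [B] contains both [d] and [x],
     or lacks [d]; then exchanging [d] for [x] in [A] does not enlarge the union. *)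
  have mixed A B : A \in F -> P x A -> B \in F ->
      (P x B -> phi x B \in F) -> #|phi x A :|: B| <= m.
    move=> AF /and3P[xX xA dA] BF stB; case: (boolP (P x B)) => PB.
      apply: leq_trans (uF _ _ AF (stB PB)); apply/subset_leq_card/subsetP => y.
      rewrite !inE; case: (eqVneq y d) => [->|_]; first by rewrite dA.
      by case: (y == x); case: (y \in A); case: (y \in B).
    apply: leq_trans (uF _ _ AF BF).
    case: (boolP (d \in B)) => dB.
      have xB : x \in B by move: PB; rewrite /P xX dB andbT /= negbK.
      apply/subset_leq_card/subsetP => y.
      rewrite !inE; case: (eqVneq y x) => [->|_]; first by rewrite xB !orbT.
      by case: (y == d); case: (y \in A).
    apply: leq_trans (card_shift (A :|: B) _); last by rewrite !inE dA.
    apply/subset_leq_card/subsetP => y; rewrite !inE.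
    case: (eqVneq y d) => [->|_]; first by rewrite (negbTE dB) /= !orbF.
    by rewrite -orbA.
  move=> A B /compress_cases[[AF stA]|[A0 [AF xA] ->]];
    move=> /compress_cases[[BF stB]|[B0 [BF xB] ->]].
  + exact: uF.
  + by rewrite setUC; exact: mixed.
  + exact: mixed.
  + apply: leq_trans (uF _ _ AF BF).
    case/and3P: xA => _ _ dA.
    apply: leq_trans (card_shift (A0 :|: B0) _); last by rewrite !inE dA.
    apply/subset_leq_card/subsetP => y; rewrite !inE.
    by case: (y == x); case: (y == d).
exists G; split=> // x A AG xX xA dA; apply: stG => //.
by apply/and3P.
Qed.

(** * Kleitman's diameter theorem *)

(** The size of a Hamming ball of radius [t] in {0,1}^n. *)
Definition ball (n t : nat) : nat := \sum_(i < t.+1) 'C(n, i).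

Lemma ballS (n t : nat) : ball n.+1 t.+1 = ball n t.+1 + ball n t.
Proof.
rewrite /ball big_ord_recl [X in _ = X + _]big_ord_recl !bin0 -addnA; congr addn.
by rewrite -big_split; apply: eq_bigr => i _; rewrite /= /bump /= binS.
Qed.

Lemma ball_half (t : nat) : 2 * ball t.*2.+1 t = 2 ^ t.*2.+1.
Proof.
have -> : 2 ^ t.*2.+1 = \sum_(0 <= i < t.*2.+2) 'C(t.*2.+1, i).
  rewrite -[2]/(1 + 1) expnDn big_mkord; apply: eq_bigr => i _.
  by rewrite !exp1n !muln1.
rewrite (@big_cat_nat _ _ _ t.+1) //=; last by lia.
rewrite big_mkord -/(ball _ _) mul2n -addnn; congr addn.
rewrite big_nat_rev /= -{1}[t.+1]add0n big_addn.
have -> : t.*2.+2 - t.+1 = t.+1 by lia.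
rewrite big_mkord; apply: eq_bigr => i _.
by rewrite -bin_sub; [congr 'C(_, _)|]; have := ltn_ord i; lia.
Qed.

(** For positive [n], the size of the extremal configuration: a ball or, for odd [m], a ball in all
    coordinates but one, which stays free. *)
Definition kleitman_bound (n m : nat) : nat :=
  if odd m then 2 * ball n.-1 m./2 else ball n m./2.

Lemma kleitman_bound_rec (n m : nat) :
  kleitman_bound n.+2 m.+2 = kleitman_bound n.+1 m.+2 + kleitman_bound n.+1 m.
Proof.
by rewrite /kleitman_bound /= negbK; case: odd; rewrite ballS // mulnDr.
Qed.

Lemma kleitman_bound_half (m : nat) : kleitman_bound m.+1 m = 2 ^ m.
Proof.
rewrite /kleitman_bound; have := odd_double_half m; case: odd => /= E.
  by rewrite -{1 3}E add1n ball_half.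
by apply/eqP; rewrite -(eqn_pmul2l (isT : 0 < 2)) -expnS -{1 3}E ball_half.
Qed.

Lemma card_bounded_union (T : finType) (X : {set T}) (m : nat)
    (F : {set {set T}}) :
  F \subset powerset X -> {in F &, forall A B, #|A :|: B| <= m} -> m < #|X| ->
  #|F| <= kleitman_bound #|X| m.
Proof.
have [n] := ubnP #|X|; elim: n => // n IHn in X m F *.
rewrite ltnS => leXn FX uF; rewrite leq_eqVlt => /predU1P[EX|ltmX].
  (* No member is the complement of a member, as their union would be all of [X], of size [m.+1]; so
     at most half of the subsets occur. *)
  rewrite -EX kleitman_bound_half.
  pose Fc := [set X :\: A | A in F].
  have cFc : #|Fc| = #|F|.
    apply: card_in_imset => A B /(subsetP FX) + /(subsetP FX).
    rewrite !powersetE => /setIidPr AX /setIidPr BX E.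
    by rewrite -AX -BX -[_ :&: A]set0U -[_ :&: B]set0U -(setDv X) -!setDDr E.
  have disFc : [disjoint F & Fc].
    rewrite disjoint_subset; apply/subsetP => A AF; rewrite !inE.
    apply/imsetP => -[B BF EA]; have := uF _ _ AF BF; rewrite EA setUC setDE.
    rewrite setUIr setUCr setIT (setUidPr _) -?EX ?ltnn //.
    by have := subsetP FX _ BF; rewrite powersetE.
  rewrite -leq_double -mul2n -[leqRHS]mul2n -expnS EX -card_powerset.
  rewrite mul2n -addnn -{2}cFc.
  have /leqifP := leq_card_setU F Fc; rewrite disFc => /eqP <-.
  apply/subset_leq_card; rewrite subUset FX; apply/subsetP => A /imsetP[B _ ->].
  by rewrite powersetE subsetDl.
have /set0Pn[d dX] : X != set0 by rewrite -card_gt0; apply: leq_ltn_trans ltmX.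
have [G [GX <- uG stG]] := union_shifted d FX uF.
pose G1 := [set A in G | d \notin A].
pose G2 := [set A :\ d | A in [set A in G | d \in A]].
have cG : #|G| = #|G1| + #|G2|.
  rewrite card_in_imset => [|A B]; last first.
    by rewrite !inE => /andP[_ dA] /andP[_ dB] E; rewrite -(setD1K dA) E setD1K.
  rewrite -(cardsID [set A : {set T} | d \in A]) addnC.
  by congr (_ + _); apply: eq_card => A; rewrite !inE // andbC.
have G1X : G1 \subset powerset (X :\ d).
  apply/subsetP => A; rewrite !inE => /andP[/(subsetP GX) + dA].
  by rewrite powersetE subsetD1 => ->.
have G2X : G2 \subset powerset (X :\ d).
  apply/subsetP => _ /imsetP[A + ->]; rewrite inE => /andP[/(subsetP GX) + dA].
  by rewrite !powersetE => /setSD.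
have uG1 : {in G1 &, forall A B, #|A :|: B| <= m}.
  by move=> A B; rewrite !inE => /andP[? _] /andP[? _]; exact: uG.
(* One element is lost with [d]. Another is lost because a union of size [m] would miss some [x] in
   [X], and shifting [d] to [x] in [B] alone would give a union of size [m.+1]. *)
have uG2 : {in G2 &, forall A B, #|A :|: B|.+1 < m}.
  move=> _ _ /imsetP[A + ->] /imsetP[B + ->].
  rewrite !inE => /andP[AG dA] /andP[BG dB]; rewrite -setDUl.
  have -> : #|(A :|: B) :\ d|.+1 = #|A :|: B|.
    by rewrite [RHS](cardsD1 d) !inE dA.
  rewrite ltn_neqAle uG // andbT; apply/eqP => Em.
  have /subsetPn[x xX] : ~~ (X \subset A :|: B).
    by apply/negP => /subset_leq_card; rewrite Em leqNgt (ltnW ltmX).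
  rewrite !inE negb_or => /andP[xA xB].
  have := uG _ _ AG (stG _ _ BG xX xB dB).
  rewrite (_ : A :|: _ = x |: (A :|: B)); last first.
    apply/setP => y; rewrite !inE; case: (eqVneq y d) => [->|_].
      by rewrite dA !orbT.
    by rewrite orbCA.
  by rewrite cardsU1 !inE negb_or xA xB Em ltnn.
have cX := cardsD1 d X; rewrite dX add1n in cX.
have leG1 : #|G1| <= kleitman_bound #|X :\ d| m.
  by apply: IHn => //; rewrite -ltnS -cX.
(* For [m < 2], [uG2] leaves [G2] empty and the bound is the constant 1 or 2. *)
rewrite {}cG cX; case: m => [|[|m]] in FX uF ltmX uG stG uG1 uG2 leG1 *.
- have -> : G2 = set0.
    by apply/eqP/set0Pn => -[A AG2]; have := uG2 _ _ AG2 AG2.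
  rewrite cards0 addn0 (leq_trans leG1) // /kleitman_bound /ball /=.
  by rewrite !big_ord_recl !big_ord0 !bin0.
- have -> : G2 = set0.
    by apply/eqP/set0Pn => -[A AG2]; have := uG2 _ _ AG2 AG2.
  rewrite cards0 addn0 (leq_trans leG1) // /kleitman_bound /ball /=.
  by rewrite !big_ord_recl !big_ord0 !bin0.
have leG2 : #|G2| <= kleitman_bound #|X :\ d| m.
  apply: IHn => //; first by rewrite -cX.
  by rewrite -ltnS -cX; do 2 apply: ltnW.
have [p Ep] : exists p, #|X :\ d| = p.+1.
  by exists #|X :\ d|.-1; rewrite prednK // -ltnS -cX; apply: leq_ltn_trans ltmX.
by rewrite Ep kleitman_bound_rec -Ep leq_add.
Qed.

(* Kleitman's diameter theorem. *)
Lemma card_bounded_diameter (T : finType) (m : nat) (F : {set {set T}}) :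
  {in F &, forall A B, #|symdiff A B| <= m} -> m < #|T| ->
  #|F| <= kleitman_bound #|T| m.
Proof.
have FT : F \subset powerset [set: T].
  by apply/subsetP => A _; rewrite powersetE subsetT.
move=> /(diameter_compressed FT)[G [GT <- uG]]; rewrite -cardsT.
exact: card_bounded_union.
Qed.

Lemma card_small_subsets (T : finType) (B : {set T}) (t : nat) :
  #|[set A : {set T} | (A \subset B) && (#|A| <= t)]| = ball #|B| t.
Proof.
elim: t => [|t IHt].
  rewrite /ball big_ord1 bin0 (_ : [set A | _] = [set set0]) ?cards1 //.
  apply/setP => A; rewrite !inE leqn0 cards_eq0.
  by case: eqVneq => [->|_]; rewrite ?sub0set ?andbF.
rewrite /ball big_ord_recr /= -/(ball _ _) -IHt -cards_draws -cardsUI.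
rewrite [X in _ = _ + X]eq_card0 ?addn0 => [|A].
  apply: eq_card => A.
  by rewrite !inE -andb_orr leq_eqVlt ltnS orbC.
by rewrite !inE; case: eqVneq => [->|]; rewrite ?andbF // ltnn andbF.
Qed.

(** * Pairwise separated subcubes *)

Section Subcubes.

Variables (T I : finType) (L U : I -> {set T}) (k : nat).

(** A point of {0,1}^T is a subset of [T]. The [i]-th subcube has ones on [L i], zeros off [U i] and
    stars in between. *)
Definition separation (i j : I) : {set T} := (L i :\: U j) :|: (L j :\: U i).
Definition stars (i : I) : nat := #|U i :\: L i|.
Definition cube (i : I) : {set {set T}} :=
  [set A : {set T} | (L i \subset A) && (A \subset U i)].
Definition cover_up_to (j : nat) : {set {set T}} :=
  [set A | [exists i, (stars i <= j) && (A \in cube i)]].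

Hypothesis LU : forall i, L i \subset U i.
Hypothesis sepP : forall i j, i != j -> 0 < #|separation i j| <= k.

Lemma card_separation (i j : I) : #|separation i j| <= k.
Proof.
have [->|/sepP/andP[]//] := eqVneq i j.
by rewrite /separation setUid (eqP (_ : L j :\: U j == set0)) ?cards0 // setD_eq0.
Qed.

Lemma cube_inj (A : {set T}) (i j : I) : A \in cube i -> A \in cube j -> i = j.
Proof.
rewrite !inE => /andP[LiA AUi] /andP[LjA AUj]; apply/eqP; apply: contraT.
case/sepP/andP; rewrite card_gt0 => /negP[]; rewrite setU_eq0 !setD_eq0.
by rewrite (subset_trans LiA) ?(subset_trans LjA).
Qed.

Lemma card_cube (i : I) : #|cube i| = 2 ^ stars i.
Proof.
rewrite -card_powerset.
rewrite -(@card_in_imset _ _ (fun B => L i :|: B) (powerset _)) => [|A B].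
  apply: eq_card => A; rewrite inE; apply/andP/imsetP => [[LA AU]|[B + ->]].
    exists (A :\: L i); first by rewrite powersetE setSD.
    by rewrite setDE setUIr setUCr setIT (setUidPr LA).
  by rewrite powersetE subsetUl subUset LU subsetD => /andP[-> _].
rewrite !powersetE !subsetD => /andP[_ disA] /andP[_ disB] E.
have K (C : {set T}) : [disjoint C & L i] -> (L i :|: C) :\: L i = C.
  by move=> dis; rewrite setDUl setDv set0U; apply/setDidPl.
by rewrite -(K A) // E K.
Qed.

(* Every subcube contains a point that agrees with the [i0]-th one off [H],
   except in at most [k] coordinates. *)
Lemma card_subcubes_few_stars (i0 : I) (h : nat) :
  stars i0 <= h -> h <= #|T| -> #|I| <= 2 ^ h * ball (#|T| - h) k.
Proof.
move=> leh hT.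
(* The stars of [i0] are padded to exactly [h] coordinates. *)
have [H [sH cH]] : exists H : {set T}, U i0 :\: L i0 \subset H /\ #|H| = h.
  have [n En] : exists n, h = stars i0 + n by exists (h - stars i0); rewrite subnKC.
  elim: n h {leh} hT En => [|n IHn] h hT En.
    by exists (U i0 :\: L i0); rewrite En addn0.
  have [|H [sH cH]] := IHn (stars i0 + n) _ erefl; first lia.
  have /set0Pn[x] : ~: H != set0 by rewrite -card_gt0 cardsCs setCK cH; lia.
  rewrite inE => xH; exists (x |: H).
  by rewrite cardsU1 xH cH En addnS add1n (subset_trans sH) ?subsetUr.
pose p i := L i :|: (L i0 :&: U i).
have pcube i : p i \in cube i by rewrite inE subsetUl subUset LU subsetIr.
pose q i := symdiff (p i) (L i0).
(* The part in [H] is arbitrary and the part off [H] has at most [k] elements, whence the two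
   factors. *)
pose f i := (q i :&: H, q i :\: H).
have inj_f : injective f.
  move=> i j [E1 E2]; have Eq : q i = q j by rewrite -(setID (q i) H) E1 E2 setID.
  have Ep : p i = p j.
    apply/setP => x; move/setP/(_ x): Eq; rewrite !inE.
    by do 5 case: (x \in _).
  by apply: (@cube_inj (p i)); rewrite // Ep.
rewrite -cardsT -(card_imset _ inj_f) -cH -card_powerset.
rewrite -(cardsC H) addKn -card_small_subsets -cardsX.
apply/subset_leq_card/subsetP => _ /imsetP[i _ ->].
rewrite inE /= !inE subsetIr setDE subsetIr /=.
apply: leq_trans (card_separation i i0); apply/subset_leq_card/subsetP => x.
rewrite !inE => /andP[+ xH]; have /contraNN/(_ xH) := subsetP sH x.
have := subsetP (LU i) x; rewrite !inE.
by do 4 case: (x \in _).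
Qed.

(** Points of two subcubes differ only at separating coordinates or at stars of either one, which
    bounds the diameter for Kleitman's theorem. *)
Lemma card_cover_up_to (j : nat) :
  k + 2 * j < #|T| -> #|cover_up_to j| <= kleitman_bound #|T| (k + 2 * j).
Proof.
move=> ltT; apply: card_bounded_diameter => // A B.
rewrite !inE => /existsP[i /andP[si Ai]] /existsP[i' /andP[si' Bi']].
have := leq_add (card_separation i i') (leq_add si si').
rewrite addnn -mul2n; apply: leq_trans; rewrite /stars.
apply: leq_trans (leq_add (leqnn _) (leq_card_setU _ _).1).
apply: leq_trans (leq_card_setU _ _).1; apply/subset_leq_card/subsetP => x.
move: Ai Bi'; rewrite !inE => /andP[LA AU] /andP[LB BU].
have := (introT implyP (subsetP LA x), introT implyP (subsetP AU x)).
have := (introT implyP (subsetP LB x), introT implyP (subsetP BU x)).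
by move=> [+ +] [+ +]; do 6 case: (x \in _).
Qed.

(** Antipodal points differ everywhere, so every coordinate is separating or a star of one of the
    subcubes. *)
Lemma antipodal_stars (A : {set T}) (i j : I) :
  A \in cube i -> ~: A \in cube j -> #|T| <= k + (stars i + stars j).
Proof.
move=> Ai Aj; rewrite -cardsT.
apply: leq_trans (leq_add (card_separation i j) (leqnn _)); rewrite /stars.
apply: leq_trans (leq_add (leqnn _) (leq_card_setU _ _).1).
apply: leq_trans (leq_card_setU _ _).1; apply/subset_leq_card/subsetP => x _.
move: Ai Aj; rewrite !inE => /andP[LA AU] /andP[LB BU].
have := (introT implyP (subsetP LA x), introT implyP (subsetP AU x)).
have := (introT implyP (subsetP LB x), introT implyP (subsetP BU x)).
by rewrite !inE => -[+ +] [+ +]; do 5 case: (x \in _).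
Qed.

(** * Weights of antipodal pairs *)

Section Weights.
Variable R : realFieldType.
Local Open Scope ring_scope.

(** By [cube_inj] at most one term is present. The form of a sum gives uncovered points weight 0 and
    makes [sum_weight] an exchange of summations. *)
Definition weight (A : {set T}) : R := \sum_(i | A \in cube i) 2 ^- stars i.

Lemma sum_weight : \sum_(A : {set T}) weight A = #|I|%:R.
Proof.
rewrite /weight (exchange_big_dep predT) //= -sum1_card natr_sum.
apply: eq_bigr => i _.
rewrite sumr_const (eq_card (_ : _ =i cube i)) // card_cube.
by rewrite -[LHS]mulr_natr natrX mulVf // expf_neq0 // pnatr_eq0.
Qed.

Lemma weight_cube (A : {set T}) (i : I) : A \in cube i -> weight A = 2 ^- stars i.
Proof.
move=> Ai; rewrite /weight (bigD1 i) //= big1 ?addr0 // => j /andP[Aj].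
by rewrite (cube_inj Aj Ai) eqxx.
Qed.

Lemma weight_le (A : {set T}) (s : nat) :
  (forall i, A \in cube i -> (s <= stars i)%N) -> weight A <= 2 ^- s.
Proof.
move=> sA; have [i Ai|nA] := pickP (fun i => A \in cube i).
  rewrite (weight_cube Ai) lef_pV2 ?posrE ?exprn_gt0 ?ltr0n //.
  by rewrite ler_eXn2l ?ltr1n ?sA.
by rewrite /weight big_pred0 // invr_ge0 exprn_ge0 // ler0n.
Qed.

(* [g j] bounds the total weight of a pair of antipodal points whose smaller
   star number is [j]. *)
Lemma weight_antipodal (g : nat -> R) (h M : nat) (A : {set T}) :
  (forall i, (h < stars i)%N) ->
  (forall j, (j < M)%N -> 2 ^- j + 2 ^- (#|T| - k - j) <= g j) ->
  2 ^- M + 2 ^- M <= g M ->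
  (forall j, (j < M)%N -> g j.+1 <= g j) ->
  weight A + weight (~: A) <=
    \sum_(h.+1 <= j < M) (g j - g j.+1) *
      ((A \in cover_up_to j)%:R + (~: A \in cover_up_to j)%:R) + g M.
Proof.
move=> hh hg hM hdec; set S := BIG_F.
have S_ge0 j : (j < M)%N -> 0 <= S j.
  by move=> jM; rewrite /S mulr_ge0 ?subr_ge0 ?hdec // addr_ge0 // ler0n.
(* [Si] will hold because the point lies in [cover_up_to j] from its star number on. These terms
   telescope to [g (stars i) - g M], and the earlier ones are nonnegative. *)
have low (B : {set T}) i : B \in cube i -> (stars i < M)%N ->
    (forall j, (stars i <= j < M)%N -> g j - g j.+1 <= S j) ->
    weight B + weight (~: B) <= \sum_(h.+1 <= j < M) S j + g M.
  move=> Bi iM Si.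
  have wB : weight B + weight (~: B) <= g (stars i).
    rewrite (weight_cube Bi); apply: le_trans (hg _ iM); rewrite lerD2l.
    by apply: weight_le => i' Bi'; have := antipodal_stars Bi Bi'; lia.
  apply: le_trans wB _; rewrite (@big_cat_nat _ _ _ (stars i)) //=; last exact: ltnW.
  rewrite -addrA ler_wpDl //.
    by rewrite big_nat sumr_ge0 // => j /andP[_ ji]; apply/S_ge0/(ltn_trans ji).
  rewrite -lerBlDr -opprB -telescope_sumr 1?ltnW // -sumrN.
  apply: ler_sum_nat => j jr.
  by rewrite opprB Si.
have [i Ai|nA] := pickP (fun i => (A \in cube i) && (stars i < M)%N).
  case/andP: Ai => Ai iM; apply: (low _ i) => // j /andP[ij jM].
  have Aj : A \in cover_up_to j by rewrite inE; apply/existsP; exists i; rewrite ij.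
  by rewrite /S ler_peMr ?subr_ge0 ?hdec // Aj lerDl ler0n.
have [i Ai|nA'] := pickP (fun i => (~: A \in cube i) && (stars i < M)%N).
  case/andP: Ai => Ai iM; rewrite addrC -[X in _ + weight X]setCK.
  apply: (low _ i) => // j /andP[ij jM].
  have Aj : ~: A \in cover_up_to j.
    by rewrite inE; apply/existsP; exists i; rewrite ij.
  by rewrite /S ler_peMr ?subr_ge0 ?hdec // Aj lerDr ler0n.
(* No star number of the pair is below [M], so [g M] alone suffices. *)
rewrite ler_wpDl //.
  by rewrite big_nat sumr_ge0 // => j /andP[_]; exact: S_ge0.
apply: le_trans hM; rewrite lerD // weight_le // => i Ai; rewrite leqNgt.
  by have := nA i; rewrite Ai /= => ->.
by have := nA' i; rewrite Ai /= => ->.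
Qed.

(** Summing [weight_antipodal] over all points counts each pair twice. [g] and [M] stay general
    because the two parities of [d - k] need different choices. *)
Lemma card_subcubes_many_stars (g : nat -> R) (h M : nat) :
  (forall i, (h < stars i)%N) ->
  (forall j, (j < M)%N -> 2 ^- j + 2 ^- (#|T| - k - j) <= g j) ->
  2 ^- M + 2 ^- M <= g M ->
  (forall j, (j < M)%N -> g j.+1 <= g j) ->
  (forall j, (j < M)%N -> (k + 2 * j < #|T|)%N) ->
  #|I|%:R <=
    \sum_(h.+1 <= j < M) (g j - g j.+1) * (kleitman_bound #|T| (k + 2 * j))%:R
    + 2 ^+ #|T| * g M / 2.
Proof.
move=> hh hg hM hdec hT.
have sumC (F : {set T} -> R) : \sum_A F (~: A) = \sum_A F A.
  by rewrite [RHS](reindex_inj (@setC_inj T)).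
have sum_in (E : {set {set T}}) : \sum_A (A \in E)%:R = #|E|%:R :> R.
  by rewrite -natr_sum -sum1_card [in RHS]big_mkcond /=.
suff : 2 * #|I|%:R <= \sum_(h.+1 <= j < M) (g j - g j.+1) *
    (2 * #|cover_up_to j|%:R) + 2 ^+ #|T| * g M.
  have : \sum_(h.+1 <= j < M) (g j - g j.+1) * #|cover_up_to j|%:R <=
    \sum_(h.+1 <= j < M) (g j - g j.+1) * (kleitman_bound #|T| (k + 2 * j))%:R.
    apply: ler_sum_nat => j /andP[_ jM].
    by rewrite ler_wpM2l ?subr_ge0 ?hdec // ler_nat card_cover_up_to ?hT.
  under [in X in _ -> X]eq_bigr do rewrite mulrCA.
  rewrite -mulr_sumr; lra.
rewrite -sum_weight mulr_natl mulr2n -{2}sumC -big_split /=.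
apply: le_trans (ler_sum _ (fun A _ => weight_antipodal A hh hg hM hdec)) _.
rewrite big_split /= sumr_const exchange_big /= lerD //; last first.
  by rewrite -[X in X <= _]mulr_natl -cardsT -powersetT card_powerset cardsT natrX.
rewrite le_eqVlt; apply/orP; left; apply/eqP; apply: eq_bigr => j _.
rewrite -mulr_sumr big_split /= (sumC (fun A => (A \in cover_up_to j)%:R)).
by rewrite sum_in mulr_natl mulr2n.
Qed.

End Weights.
End Subcubes.

(** * Cardinalities of the configurations *)

Lemma card_tuples_few_ones (d t : nat) :
  #|[set v : d.-tuple bool | count id v <= t]| = ball d t.
Proof.
pose f (v : d.-tuple bool) := [set i | tnth v i].
have cf v : #|f v| = count id v.
  rewrite cardsE cardE /enum_mem size_filter -[in RHS](map_tnth_enum v).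
  by rewrite count_map enumT.
have inj_f : injective f.
  by move=> v w E; apply: eq_from_tnth => i; move/setP/(_ i): E; rewrite !inE.
rewrite -[d in RHS]card_ord -cardsT -card_small_subsets -(card_imset _ inj_f).
apply: eq_card => A; rewrite inE subsetT /=.
apply/imsetP/idP => [[v + ->]|At]; first by rewrite inE cf.
have fA : A = f [tuple i \in A | i < d].
  by apply/setP => i; rewrite inE tnth_mktuple.
by exists [tuple i \in A | i < d]; rewrite // inE -cf -fA.
Qed.

Lemma card_tuples_few_ones_behead (d t : nat) :
  #|[set v : d.+1.-tuple bool | count id (behead v) <= t]| = 2 * ball d t.
Proof.
pose f (p : bool * d.-tuple bool) := [tuple of p.1 :: p.2].
have inj_f : injective f.
  by move=> [b v] [c w] /(congr1 val) /= [-> E]; congr pair; exact: val_inj.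
rewrite -card_bool -cardsT -card_tuples_few_ones -cardsX -(card_imset _ inj_f).
apply: eq_card => v; rewrite inE; apply/idP/imsetP => [vt|[[b w] + ->]].
  exists (thead v, [tuple of behead v]); first by rewrite !inE.
  exact: tuple_eta.
by rewrite !inE.
Qed.

Require Import Defs.
From mathcomp Require Import all_classical all_reals.
Local Open Scope ring_scope.

(** At [d = 0] and odd [m] there is no coordinate to leave free: one tuple against a bound of 2. *)
Lemma card_Bconf (d m : nat) : (0 < d)%N -> #|Bconf d m| = kleitman_bound d m.
Proof.
case: d => // d _; rewrite /Bconf /kleitman_bound.
by case: odd; rewrite ?card_tuples_few_ones_behead ?card_tuples_few_ones.
Qed.

(** * Coding boxes by subcubes *)

(** Coordinates in [S] are constant on the box, so its directions lie in the span of the other basis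
    vectors. *)
Lemma has_dim_degenerate (R : realType) (d m : nat) (a b : 'I_d -> R)
    (S : {set 'I_d}) :
  has_dim [set x : 'rV[R]_d | forall i, a i <= x 0 i <= b i]%classic m ->
  (forall i, i \in S -> b i <= a i) -> (m + #|S| <= d)%N.
Proof.
move=> [x [U [Ax _ Umin <-]]] Sdeg.
have eqa (y : 'rV[R]_d) i : (forall j, a j <= y 0 j <= b j) -> i \in S ->
    y 0 i = a i.
  move=> /(_ i)/andP[ay yb] /Sdeg ba; apply/le_anti.
  by rewrite ay (le_trans yb ba).
pose e := [seq delta_mx 0 i : 'rV[R]_d | i <- enum (~: S)%SET].
have /Umin/dimvS UV : forall y : 'rV[R]_d, (forall j, a j <= y 0 j <= b j) ->
    y - x \in <<e>>%VS.
  move=> y Ay; rewrite (row_sum_delta (y - x)); apply: memv_suml => i _.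
  have [iS|iS] := boolP (i \in S).
    by rewrite !mxE (eqa y) // (eqa x) // subrr scale0r mem0v.
  by apply/memvZ/memv_span/map_f; rewrite mem_enum inE.
have := leq_add UV (leqnn #|S|).
move=> /leq_trans; apply; apply: leq_trans (leq_add (dim_span _) (leqnn _)) _.
by rewrite size_map -cardE addnC cardsC card_ord.
Qed.

(* Whenever two boxes only touch in direction [l], their common endpoint is the
   unique common point of all the projections to [l]; a box is coded by 1
   (resp. 0) at [l] if it lies above (resp. below) that point, and by a star if
   it does not end there. *)
Lemma neighborly_subcubes (R : realType) (k d m : nat) :
  (k <= d)%N -> neighborly_size R k d m ->
  exists L U : 'I_m -> {set 'I_d}, (forall i, L i \subset U i) /\
    forall i j, i != j -> (0 < #|separation L U i j| <= k)%N.
Proof.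
move=> kd [F [[_ Fbox Fpair]]] /card_esym/card_set_bijP[g [gF ginj _]].
have gFi (i : 'I_m) : F (g i) by apply: gF => /=.
have /choice[ab hab] (i : 'I_m) := standard_box_bounds (Fbox _ (gFi i)).1.
pose a i := (ab i).1; pose b i := (ab i).2.
have ltab (i : 'I_m) j : a i j < b i j.
  by apply: full_dim_lt; rewrite -hab; exact: (Fbox _ (gFi i)).2.
have gne (i j : 'I_m) : i != j -> g i <> g j.
  move=> /eqP ij e; apply: ij; apply: ord_inj.
  by apply: ginj e; rewrite inE/=.
have capE (i j : 'I_m) : (g i `&` g j = [set x | forall l,
    Num.max (a i l) (a j l) <= x 0 l <= Num.min (b i l) (b j l)])%classic.
  rewrite (hab i) (hab j); apply/seteqP; split => x /=.
    move=> [h1 h2] l; rewrite ge_max le_min.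
    by have /andP[-> ->] := h1 l; have /andP[-> ->] := h2 l.
  by move=> h; split=> l; have := h l; rewrite ge_max le_min;
    move=> /andP[/andP[? ?] /andP[? ?]]; apply/andP.
have meet (i j : 'I_m) l : a i l <= b j l.
  have [->|ij] := eqVneq i j; first exact: ltW.
  have [n [_ /has_dim_neq0[x]]] := Fpair _ _ (gFi i) (gFi j) (gne _ _ ij).
  rewrite capE => /(_ l); rewrite ge_max le_min.
  by move=> /andP[/andP[aix _] /andP[_ xbj]]; exact: le_trans aix xbj.
pose L (i : 'I_m) := [set l : 'I_d | [exists j, b j l <= a i l]]%SET.
pose U (i : 'I_m) := [set l : 'I_d | ~~ [exists j, b i l <= a j l]]%SET.
have sepE i j l :
    (l \in separation L U i j) = (b j l <= a i l) || (b i l <= a j l).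
  rewrite !inE !negbK.
  (* By [meet], a box that ends below some box and a box that begins above some box touch each
     other: all touching in direction [l] happens at one point. *)
  have touch i1 i2 : ([exists j, b i1 l <= a j l] && [exists j, b j l <= a i2 l])
      = (b i1 l <= a i2 l).
    apply/andP/idP => [[/existsP[j1 h1] /existsP[j2 h2]]|h].
      exact: le_trans (le_trans h1 (meet j1 j2 l)) h2.
    by split; apply/existsP; [exists i2 | exists i1].
  by rewrite !touch.
exists L, U; split=> [i|i j ij].
  apply/fintype.subsetP => l; rewrite !inE => /existsP[j1 h1].
  apply/existsP => -[j2 h2].
  by have := ltab i l; rewrite ltNge (le_trans h2) // (le_trans (meet j2 j1 l)).
have [n [/andP[dn nd] hn]] := Fpair _ _ (gFi i) (gFi j) (gne _ _ ij).
rewrite capE in hn; apply/andP; split.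
  apply/card_gt0P; have [l] := low_dim_degenerate hn nd.
  rewrite le_max !ge_min => deg; exists l; rewrite sepE.
  by move: deg; rewrite !leNgt !ltab /= orbF orbC.
(* Separating coordinates are degenerate in the intersection, whose dimension is at least
   [d - k]. *)
suff deg l : l \in separation L U i j ->
    Num.min (b i l) (b j l) <= Num.max (a i l) (a j l).
  rewrite -(leq_add2l n) (leq_trans (has_dim_degenerate hn deg)) //.
  by rewrite addnC -leq_subLR.
by rewrite sepE le_max !ge_min => /orP[->|->]; rewrite ?orbT.
Qed.

(** * The bounds on n(k,d) *)

Lemma neighborly_size_max (R : realType) (k d : nat) :
  neighborly_size R k d (max_neighborly R k d).
Proof. by rewrite /max_neighborly; case: ex_maxnP => n /asboolP. Qed.

Lemma max_neighborly_bound (R : realType) (k d h M : nat) (g : nat -> R) :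
  (0 < d)%N -> (k <= d)%N -> (h <= d)%N ->
  (forall j, (j < M)%N -> 2 ^- j + 2 ^- (d - k - j) <= g j) ->
  2 ^- M + 2 ^- M <= g M ->
  (forall j, (j < M)%N -> g j.+1 <= g j) ->
  (forall j, (j < M)%N -> (k + 2 * j < d)%N) ->
  (max_neighborly R k d)%:R <= Num.max
    (2 ^+ h * \sum_(0 <= j < k.+1) 'C(d - h, j)%:R)
    (\sum_(h.+1 <= j < M) (g j - g j.+1) * #|Bconf d (k + 2 * j)|%:R
      + 2 ^+ d * g M / 2).
Proof.
move=> d_gt0 kd hd hg hM hdec hMd.
have [L [U [LU sepP]]] := neighborly_subcubes kd (neighborly_size_max R k d).
rewrite le_max; apply/orP.
have [[i hi]|nh] := pselect (exists i, (stars L U i <= h)%N).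
  left; rewrite -natr_sum -natrX -natrM ler_nat big_mkord.
  by have := card_subcubes_few_stars LU sepP hi; rewrite !card_ord; apply.
right; have := @card_subcubes_many_stars _ _ L U k LU sepP R g h M.
rewrite !card_ord => /(_ _ hg hM hdec hMd); under eq_bigr do rewrite -card_Bconf //.
apply=> i; rewrite ltnNge; apply/negP => hi; apply: nh; by exists i.
Qed.

(** With [n = d - k], these are the coefficients in the theorem. *)
Lemma antipodal_weight_step (R : realFieldType) (n j : nat) : (j < n)%N ->
  (2 ^- j + 2 ^- (n - j)) - (2 ^- j.+1 + 2 ^- (n - j.+1)) =
  1 / 2 ^+ j.+1 - 1 / 2 ^+ (n - j) :> R.
Proof.
move=> jn; have -> : (n - j)%N = (n - j.+1).+1 by lia.
have nz p : 2 ^+ p != 0 :> R by rewrite expf_neq0 // pnatr_eq0.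
by rewrite !exprS; field; rewrite !nz.
Qed.

Lemma pow2V_le (R : realFieldType) (p q : nat) : (p <= q)%N ->
  2 ^- q <= 2 ^- p :> R.
Proof.
by move=> pq; rewrite lef_pV2 ?posrE ?exprn_gt0 ?ltr0n // ler_eXn2l ?ltr1n.
Qed.

(** The constant term: half of the [2 ^ d] points index the antipodal pairs, each of weight at most
    twice [2 ^- M]. *)
Lemma half_weight (R : realFieldType) (d M : nat) : (M <= d)%N ->
  2 ^+ d * (2 ^- M + 2 ^- M) / 2 = 2 ^+ (d - M) :> R.
Proof.
move=> Md; rewrite -{1}(subnK Md) exprD.
have nz : 2 ^+ M != 0 :> R by rewrite expf_neq0 // pnatr_eq0.
by field.
Qed.

Lemma le_bigmine (R : realType) (x : \bar R) (n : nat) (F : nat -> \bar R) :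
  (forall h, (h < n)%N -> (x <= F h)%E) ->
  (x <= \big[mine/+oo]_(0 <= h < n) F h)%E.
Proof.
move=> xF; rewrite big_nat; apply: (big_ind (fun y => (x <= y)%E)).
- exact: leey.
- by move=> y z xy xz; rewrite le_min xy xz.
- by move=> h /andP[_ /xF].
Qed.

Theorem theorem3p9 (R : realType) (k d : nat) (hk : (1 <= k)%N)
    (hkd : (k <= d - 1)%N) :
  (~~ odd (d - k) ->
    (((max_neighborly R k d)%:R : R)%:E <=
      \big[mine/+oo]_(0 <= h < ((d - k - 2)./2).+1)
        (Num.max
          (2 ^+ h * \sum_(0 <= j < k.+1) 'C(d - h, j)%:R)
          (\sum_(h.+1 <= j < ((d - k - 2)./2).+1)
              (1 / 2 ^+ j.+1 - 1 / 2 ^+ (d - k - j)) * #|Bconf d (k + 2 * j)|%:R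
            + 2 ^+ ((d + k)./2)))%R%:E)%E)
  /\
  (odd (d - k) ->
    (((max_neighborly R k d)%:R : R)%:E <=
      (* h <= (d-k-3)/2, the range being empty when d-k = 1 *)
      \big[mine/+oo]_(0 <= h < (d - k - 1)./2)
        (Num.max
          (2 ^+ h * \sum_(0 <= j < k.+1) 'C(d - h, j)%:R)
          (\sum_(h.+1 <= j < (d - k - 1)./2)
              (1 / 2 ^+ j.+1 - 1 / 2 ^+ (d - k - j)) * #|Bconf d (k + 2 * j)|%:R
            + 1 / 2 ^+ ((d - k + 1)./2) * #|Bconf d (d - 1)|%:R
            + 2 ^+ ((d + k - 1)./2)))%R%:E)%E
    /\
    (max_neighborly R k d)%:R <=
      Num.max
        (2 ^+ ((d - k - 1)./2) *
          \sum_(0 <= j < k.+1) 'C((d + k + 1)./2, j)%:R)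
        (2 ^+ ((d + k - 1)./2)) :> R).
Proof.
(* If one point of a pair has [j] stars, the other has at least [d - k - j]. *)
pose G j : R := 2 ^- j + 2 ^- (d - k - j).
have Gdec j : (j.*2.+1 <= d - k)%N -> G j.+1 <= G j.
  move=> jd; rewrite -subr_ge0 antipodal_weight_step ?subr_ge0; last by lia.
  by rewrite !div1r pow2V_le //; lia.
split=> [ev|od].
  (* At [M = (d - k) / 2] both terms of [G M] equal [2 ^- M]. *)
  set M := ((d - k - 2)./2).+1; have EM : (d - k = M.*2)%N by rewrite /M; lia.
  apply: le_bigmine => h hM; rewrite lee_fin.
  rewrite -[X in X + 2 ^+ _](@eq_big_nat _ _ _ _ _
    (fun j => (G j - G j.+1) * #|Bconf d (k + 2 * j)|%:R)); last first.
    by move=> j /andP[_ jM]; rewrite antipodal_weight_step //; lia.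
  have <- : 2 ^+ d * G M / 2 = 2 ^+ (d + k)./2.
    rewrite /G (_ : (d - k - M)%N = M); last by lia.
    by rewrite half_weight; [congr (_ ^+ _)|]; lia.
  apply: max_neighborly_bound => // [||||j jM|j jM]; try lia.
    by rewrite /G (_ : (d - k - M)%N = M) //; lia.
  by apply: Gdec; lia.
set N := ((d - k - 1)./2); have EN : (d - k = N.*2.+1)%N by rewrite /N; lia.
(* [G N.+1] equals [G N], but if both star numbers exceed [N] the pair weighs at most twice
   [2 ^- N.+1]. Lowering the last value yields the coefficient of the configuration of index
   [d - 1 = k + 2 * N]. *)
pose g j : R := if (j <= N)%N then G j else 2 ^- j + 2 ^- j.
have GN : G N = 2 ^- N + 2 ^- N.+1 by rewrite /G EN; congr (_ + 2 ^- _); lia.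
have gN : g N - g N.+1 = 1 / 2 ^+ ((d - k + 1)./2).
  rewrite /g leqnn ltnn GN (_ : ((d - k + 1)./2)%N = N.+1); last by lia.
  have nz : 2 ^+ N != 0 :> R by rewrite expf_neq0 // pnatr_eq0.
  by rewrite exprS; field.
have bound h : (h <= N)%N -> (max_neighborly R k d)%:R <= Num.max
    (2 ^+ h * \sum_(0 <= j < k.+1) 'C(d - h, j)%:R)
    (\sum_(h.+1 <= j < N.+1) (g j - g j.+1) * #|Bconf d (k + 2 * j)|%:R
      + 2 ^+ ((d + k - 1)./2)).
  move=> hN; have <- : 2 ^+ d * g N.+1 / 2 = 2 ^+ (d + k - 1)./2.
    by rewrite /g ltnn half_weight; [congr (_ ^+ _)|]; lia.
  apply: max_neighborly_bound => // [|||j jN||j|j jN]; try lia.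
  - by rewrite /g -ltnS jN.
  - by rewrite /g ltnn.
  rewrite ltnS leq_eqVlt => /predU1P[->|jN].
    by rewrite -subr_ge0 gN div1r invr_ge0 exprn_ge0 // ler0n.
  by rewrite /g jN (ltnW jN); apply: Gdec; lia.
split; last first.
  (* Taking [h = N] empties the sum. *)
  have := bound N (leqnn N); rewrite [X in X + 2 ^+ _]big_geq // add0r.
  by rewrite (_ : ((d + k + 1)./2)%N = (d - N)%N) //; lia.
apply: le_bigmine => h hN; rewrite lee_fin.
rewrite -[X in X + _ * _ + _](@eq_big_nat _ _ _ _ _
  (fun j => (g j - g j.+1) * #|Bconf d (k + 2 * j)|%:R)); last first.
  move=> j /andP[_ jN]; rewrite /g (ltnW jN) jN antipodal_weight_step //; lia.
have := bound h (ltnW hN) => /le_trans; apply.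
rewrite [X in Num.max _ (X + _)]big_nat_recr //= gN.
by rewrite (_ : (k + 2 * N)%N = (d - 1)%N) //; lia.
Qed.
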